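(* Let $b,s,k>0$ be integers such that $$D=D(b,s,k)=(4bs+1)^k+\bigl(b(4bs+1)^k+s\bigr)^2$$ is squarefree. If $\gcd(b,s)>2$, then $h(D)>1$.
   Context: For a squarefree integer $D>1$, $h(D)$ denotes the class number of the real quadratic field $\mathbb{Q}(\sqrt D)$. *)

(* Defs.v *)
From HB Require Import structures.
From mathcomp Require Import all_boot all_order all_algebra all_field.
From mathcomp Require Import finmap.
From mathcomp Require Import all_classical.

Set Implicit Arguments.
Unset Strict Implicit.
Unset Printing Implicit Defensive.

Import Order.TTheory GRing.Theory Num.Theory.

Local Open Scope classical_set_scope.
Local Open Scope ring_scope.

Definition squarefree (n : nat) : Prop :=
  forall d : nat, (d * d %| n)%N -> d = 1%N.

Definition Dval (b s k : nat) : nat :=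
  ((4 * b * s + 1) ^ k + (b * (4 * b * s + 1) ^ k + s) ^ 2)%N.

(* Q(sqrt D) is embedded in the algebraic complex numbers, where [sqrtC D%:R] is
   the nonnegative square root of D. *)
Definition quad_field (D : nat) : set algC :=
  [set z | exists x y : rat, z = ratr x + ratr y * sqrtC D%:R].

Definition quad_int (D : nat) : set algC :=
  [set z | quad_field D z /\ z \in Aint].

Definition nonzero_ideal (D : nat) (I : set algC) : Prop :=
  [/\ I `<=` quad_int D,
      exists2 x, I x & x != 0,
      forall x y, I x -> I y -> I (x + y) &
      forall a x, quad_int D a -> I x -> I (a * x)].

(* I ~ J when a I = c J for some nonzero integers a and c of Q(sqrt D),
   i.e. when I and J differ by a principal fractional ideal. *)
Definition ideal_equiv (D : nat) (I J : set algC) : Prop :=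
  exists a c : algC,
    [/\ quad_int D a, quad_int D c, a != 0, c != 0 &
        [set a * x | x in I] = [set c * x | x in J]].

Definition ideal_class (D : nat) (I : set algC) : set (set algC) :=
  [set J | nonzero_ideal D J /\ ideal_equiv D I J].

Definition class_group (D : nat) : set (set (set algC)) :=
  [set ideal_class D I | I in nonzero_ideal D].

(* [fset_set] sends an infinite set to the empty one, so that 1 < class_number D
   means that the class group is finite, of order at least 2. *)
Definition class_number (D : nat) : nat := #|` fset_set (class_group D)|%fset.

(* Main.v *)
Require Import Defs.
From HB Require Import structures.
From mathcomp Require Import all_boot all_order all_algebra all_field.
From mathcomp Require Import ring lra zify.
From mathcomp Require Import finmap.
From mathcomp Require Import all_classical.

(* Put n = 4bs+1, K = n^k, P = bK+s and R = bK-s, so that D = P^2 + K = R^2 + nK.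
   The forms A x^2 - 2P xy - C y^2 with AC = K and A x^2 - 2R xy - C y^2 with
   AC = nK, where A and C are powers of n, are exchanged (up to sign) by the
   substitutions x = qy + z with q = 2bK/A: this is the continued fraction cycle
   of sqrt D, run as a descent on nonnegative pairs (x, y). It shows that a value
   |x^2 - D y^2| < bK is a power of n times a square.

   Let p be a prime dividing gcd(b, s), with p odd or 4 | gcd(b, s). Then p splits,
   and if a prime above p were principal, generated by (u + v sqrt D) / 2, then
   |u^2 - D v^2| = 4p < n, so 4p would be a square, which it is not.

   The class group is finite because every ideal is equivalent to one containing D!:
   if g is an element of least norm of an ideal and z is any other element, some
   multiple t z with 1 <= t <= D differs from a multiple of g by an element
   of smaller norm. *)

Set Implicit Arguments.
Unset Strict Implicit.
Unset Printing Implicit Defensive.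

Import Order.TTheory GRing.Theory Num.Theory.

Local Open Scope classical_set_scope.
Local Open Scope ring_scope.

(** * Descent on indefinite binary quadratic forms and small norms *)

Definition bqf (A B C x y : int) : int := A * x ^+ 2 - 2 * B * x * y - C * y ^+ 2.

(** One continued fraction step with partial quotient q. The sign is taken out so that, along the
    cycle, both outer coefficients stay positive. *)
Lemma bqf_shift (A B C q y z : int) :
  bqf A B C (q * y + z) y =
  - bqf (C + 2 * B * q - A * q ^+ 2) (A * q - B) A y z.
Proof. rewrite /bqf; ring. Qed.

(** Used contrapositively: a small value at positive x and y forces x >= q y, so z = x - q y is
    again nonnegative. The difference of the two sides is a sum of three nonnegative terms. *)
Lemma bqf_lower (A B C q x y : int) : 0 <= A -> 0 <= C -> A * q <= 2 * B ->
  1 <= x -> 1 <= y -> x + 1 <= q * y ->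
  A * q * y - A <= - bqf A B C x y.
Proof.
move=> A0 C0 qB x1 y1 xq.
have h1 : 0 <= C * y ^+ 2 by rewrite mulr_ge0 ?sqr_ge0.
have h2 : 0 <= (x - 1) * (A * (q * y - (x + 1))).
  by rewrite mulr_ge0 ?mulr_ge0 ?subr_ge0.
have h3 : 0 <= (2 * B - A * q) * (x * y).
  rewrite mulr_ge0 ?subr_ge0 //; apply: mulr_ge0; lia.
have -> : - bqf A B C x y = (A * q * y - A) + (C * y ^+ 2) +
   (x - 1) * (A * (q * y - (x + 1))) + (2 * B - A * q) * (x * y).
  by rewrite /bqf; ring.
lia.
Qed.

Section Descent.
Variables (b s k : nat).
Hypotheses (b_gt0 : (0 < b)%N) (s_gt0 : (0 < s)%N).
Let n := (4 * b * s + 1)%N.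
Let P : int := ((b * n ^ k)%N : int) + s%:Z.
Let R : int := ((b * n ^ k)%N : int) - s%:Z.

Let pow_times_square (v : int) := exists j f : nat, `|v| = ((n ^ j * f ^ 2)%N : int).

(** On the axes the value is A x^2 or - C y^2, of the required shape since A and C are powers of n.
    Off the axes the hypothesis on x < q y leaves x = q y + z, and passing to (y, z) decreases the
    coordinate sum because q y > 0. *)
Lemma descent_step (A B C : int) (q x y : nat) (ja jc : nat) :
  A = (n ^ ja)%N -> C = (n ^ jc)%N ->
  (0 < q)%N ->
  ((0 < x)%N -> (0 < y)%N -> (x < q * y)%N ->
     (b * n ^ k)%N%:Z <= - bqf A B C x y) ->
  `|bqf A B C x y| < (b * n ^ k)%N ->
  (forall z : nat, (y + z < x + y)%N ->
      `|bqf (C + 2 * B * q%:Z - A * q%:Z ^+ 2) (A * q%:Z - B) A y z| < (b * n ^ k)%N ->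
    pow_times_square (bqf (C + 2 * B * q%:Z - A * q%:Z ^+ 2) (A * q%:Z - B) A y z)) ->
  pow_times_square (bqf A B C x y).
Proof.
move=> EA EC q0 low small IH.
have [y0|y0] := posnP y.
  exists ja, x; rewrite y0 /bqf EA.
  have -> : (n ^ ja)%N%:Z * x%:Z ^+ 2 - 2 * B * x%:Z * 0 - C * 0 ^+ 2 = (n ^ ja * x ^ 2)%N.
    by rewrite PoszM -!rmorphXn /=; ring.
  by [].
have [x0|x0] := posnP x.
  exists jc, y; rewrite x0 /bqf EC.
  have -> : A * 0 ^+ 2 - 2 * B * 0 * y%:Z - (n ^ jc)%N%:Z * y%:Z ^+ 2 = - ((n ^ jc * y ^ 2)%N : int).
    by rewrite PoszM -!rmorphXn /=; ring.
  by rewrite normrN.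
have [xq|xq] := ltnP x (q * y).
  have := low x0 y0 xq; have := ler_norm (- bqf A B C x y); rewrite normrN; lia.
have Ex : x%:Z = q%:Z * y%:Z + (x - q * y)%N%:Z by lia.
move: small; rewrite Ex bqf_shift normrN => small.
have zx : (y + (x - q * y) < x + y)%N.
  by rewrite [X in (X < _)%N]addnC ltn_add2r ltn_subrL x0 muln_gt0 q0 y0.
have [j [f E]] := IH _ zx small.
by exists j, f; rewrite normrN.
Qed.

Lemma expnD_int i j : ((n ^ (i + j))%N : int) = (n ^ i)%N%:Z * (n ^ j)%N%:Z.
Proof. by rewrite expnD PoszM. Qed.

(** Both families go through one induction because for A q = 2bK the step exchanges them: with q =
    2b n^c the new coefficient is n^c + 2sq = n^(c+1) for P, and n^(c+1) - 2sq = n^c for R, while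
    2bK - P = R. The bound A q <= 2B of [bqf_lower] holds for P but not for R. *)
Lemma descent N (x y : nat) : (x + y < N)%N ->
  (forall a c, (a + c)%N = k -> `|bqf (n ^ a)%N P (n ^ c)%N x y| < (b * n ^ k)%N ->
     pow_times_square (bqf (n ^ a)%N P (n ^ c)%N x y)) /\
  (forall a c, (a + c).+1 = k -> `|bqf (n ^ a.+1)%N R (n ^ c.+1)%N x y| < (b * n ^ k)%N ->
     pow_times_square (bqf (n ^ a.+1)%N R (n ^ c.+1)%N x y)).
Proof.
have n_gt0 : (0 < n)%N by rewrite /n addn1.
have nE : n%:Z = 4 * b%:Z * s%:Z + 1 by rewrite /n; lia.
have K0 (i : nat) : (0 < n ^ i)%N by rewrite expn_gt0 n_gt0.
have KbK : (n ^ k <= b * n ^ k)%N by rewrite leq_pmull.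
elim: N x y => [//|N IH] x y xyN.
split=> a c acK small.
- have [a0|a0] := posnP a.
    have ck : c = k by lia.
    rewrite a0 ck in small *.
    (* For A = 1 the quotient is 2P instead of 2bK: the form (1, P, K) goes to (K, P, 1), within the
       same family. *)
    pose q := (2 * (b * n ^ k + s))%N.
    have Eq : q%:Z = 2 * P by rewrite /q /P; lia.
    apply: (@descent_step _ _ _ q _ _ 0%N k) => //.
    + rewrite /q; lia.
    + move=> x0 y0 xq; have := @bqf_lower (n ^ 0)%N P (n ^ k)%N q x y.
      rewrite expn0 => /(_ isT isT).
      have := K0 k; nia.
    + move=> z yz.
      have -> : (n ^ k)%N%:Z + 2 * P * q%:Z - (n ^ 0)%N%:Z * q%:Z ^+ 2 = (n ^ k)%N.
        rewrite Eq expn0; ring.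
      have -> : (n ^ 0)%N%:Z * q%:Z - P = P by rewrite Eq expn0; ring.
      by apply: (proj1 (IH y z _)); lia.
  case: a a0 acK small => // a _ acK small.
  pose q := (2 * b * n ^ c)%N.
  have Eq : (n ^ a.+1)%N%:Z * q%:Z = 2 * (b * n ^ k)%N%:Z.
    by rewrite -acK !PoszM expnD_int; ring.
  apply: (@descent_step _ _ _ q _ _ a.+1 c) => //.
  + by rewrite /q !muln_gt0 b_gt0 K0.
  + move=> x0 y0 xq; have := @bqf_lower (n ^ a.+1)%N P (n ^ c)%N q x y isT isT.
    (* Since A q = 2bK and A <= K <= bK, the bound A q y - A is at least bK. *)
    have := leq_pexp2l n_gt0 (_ : a.+1 <= k)%N; have := K0 k; rewrite Eq /P; nia.
  + move=> z yz.
    have -> : (n ^ c)%N%:Z + 2 * P * q%:Z - (n ^ a.+1)%N%:Z * q%:Z ^+ 2 = (n ^ c.+1)%N.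
      have -> : (n ^ a.+1)%N%:Z * q%:Z ^+ 2 = (2 * (b * n ^ k)%N%:Z) * q%:Z by rewrite -Eq; ring.
      by rewrite /P expnS !PoszM nE; ring.
    have -> : (n ^ a.+1)%N%:Z * q%:Z - P = R by rewrite Eq /P /R; ring.
    by apply: (proj2 (IH y z _)); lia.
- pose q := (2 * b * n ^ c)%N.
  have Eq : (n ^ a.+1)%N%:Z * q%:Z = 2 * (b * n ^ k)%N%:Z.
    by rewrite -acK -addSn !PoszM expnD_int; ring.
  have EC : (n ^ c.+1)%N%:Z + 2 * R * q%:Z - (n ^ a.+1)%N%:Z * q%:Z ^+ 2 = (n ^ c)%N.
    have -> : (n ^ a.+1)%N%:Z * q%:Z ^+ 2 = (2 * (b * n ^ k)%N%:Z) * q%:Z by rewrite -Eq; ring.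
    by rewrite /R expnS !PoszM nE; ring.
  have EB : (n ^ a.+1)%N%:Z * q%:Z - R = P by rewrite Eq /P /R; ring.
  apply: (@descent_step _ _ _ q _ _ a.+1 c.+1) => //.
  + by rewrite /q !muln_gt0 b_gt0 K0.
  + move=> x0 y0 xq.
    (* reflecting x in q y / 2 turns this form into one with middle coefficient P *)
    have -> : bqf (n ^ a.+1)%N R (n ^ c.+1)%N x y
      = bqf (n ^ a.+1)%N P (n ^ c)%N (q * y - x)%N y.
      have -> : (q * y - x)%N%:Z = q%:Z * y%:Z - x%:Z by lia.
      by rewrite -EC -EB /bqf; ring.
    have := @bqf_lower (n ^ a.+1)%N P (n ^ c)%N q (q * y - x)%N y isT isT.
    have := leq_pexp2l n_gt0 (_ : a.+1 <= k)%N; have := K0 k; rewrite Eq /P; nia.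
  + move=> z yz; rewrite EC EB.
    by apply: (proj1 (IH y z _)); lia.
Qed.

(** If y > 0 and x < P y, the value is at most -P < -bK. Otherwise x = P y + z, and the value is
    minus the form (K, P, 1) at (y, z), where the descent starts. *)
Lemma small_norm (x y : nat) :
  `|x%:Z ^+ 2 - ((n ^ k + (b * n ^ k + s) ^ 2)%N : int) * y%:Z ^+ 2| < (b * n ^ k)%N ->
  pow_times_square (x%:Z ^+ 2 - ((n ^ k + (b * n ^ k + s) ^ 2)%N : int) * y%:Z ^+ 2).
Proof.
have -> : ((n ^ k + (b * n ^ k + s) ^ 2)%N : int) = (n ^ k)%N%:Z + P ^+ 2.
  by rewrite PoszD -mulnn PoszM -expr2 /P PoszD.
move=> small.
have [y0|y0] := posnP y.
  exists 0%N, x; rewrite y0 expn0 mul1n -rmorphXn /=.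
  by rewrite expr0n /= mulr0 subr0.
have [xP|xP] := ltnP x ((b * n ^ k + s) * y).
  have x1 : x%:Z + 1 <= P * y%:Z by rewrite /P; lia.
  exfalso; move: small; have : P <= (P * y%:Z - x%:Z) * (P * y%:Z + x%:Z).
    rewrite /P in x1 *; nia.
  have : 0 <= (n ^ k)%N%:Z * y%:Z ^+ 2 by rewrite mulr_ge0 ?sqr_ge0.
  have -> : x%:Z ^+ 2 - ((n ^ k)%N%:Z + P ^+ 2) * y%:Z ^+ 2 =
     - ((P * y%:Z - x%:Z) * (P * y%:Z + x%:Z) + (n ^ k)%N%:Z * y%:Z ^+ 2) by ring.
  rewrite /P; lia.
pose z := (x - (b * n ^ k + s) * y)%N.
move: small.
have -> : x%:Z ^+ 2 - ((n ^ k)%N%:Z + P ^+ 2) * y%:Z ^+ 2 =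
   - bqf (n ^ k)%N P (n ^ 0)%N y z.
  have -> : x%:Z = P * y%:Z + z%:Z by rewrite /z /P; lia.
  by rewrite expn0 /bqf; ring.
rewrite normrN => small.
have [j [f E]] := proj1 (descent (ltnSn (y + z))) _ _ (addn0 k) small.
by exists j, f; rewrite normrN.
Qed.
End Descent.

Lemma no_norm_4p (b s k p : nat) (x y : int) :
  (0 < b)%N -> (0 < s)%N -> (0 < k)%N -> prime p -> (p %| b)%N ->
  `|x ^+ 2 - ((4 * b * s + 1) ^ k + (b * (4 * b * s + 1) ^ k + s) ^ 2)%N%:Z * y ^+ 2| <> (4 * p)%N.
Proof.
move=> b0 s0 k0 pp pb E.
set n := (4 * b * s + 1)%N in E *.
have n1 : (1 < n)%N by rewrite /n; nia.
(* Since p divides b, 4p <= 4b < 4bs + 1. *)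
have pn : (4 * p < n)%N by rewrite /n; have := dvdn_leq b0 pb; nia.
have Ex (v : int) : v ^+ 2 = `|v|%N%:Z ^+ 2 by rewrite abszE real_normK ?num_real.
rewrite (Ex x) (Ex y) in E.
have small : ((4 * p)%N : int) < (b * n ^ k)%N.
  rewrite ltz_nat; apply: leq_trans pn (leq_trans _ (leq_pmull _ b0)).
  by rewrite -[X in (X <= _)%N]expn1 leq_pexp2l // ltnW.
have := @small_norm b s k b0 s0 `|x|%N `|y|%N; rewrite E => /(_ small) [j [f [Ejf]]].
have j0 : j = 0%N.
  case: j Ejf => // j Ejf; exfalso.
  have : (n <= 4 * p)%N.
    apply: dvdn_leq; first by rewrite muln_gt0 (prime_gt0 pp).
    by rewrite Ejf expnS -mulnA dvdn_mulr.
  lia.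
(* The valuation of 2^2 p at p is odd, also when p = 2, whereas that of f^2 is even. *)
move: Ejf; rewrite j0 expn0 mul1n => /(congr1 (logn p)).
rewrite lognM ?(prime_gt0 pp) // (_ : 4 = 2 ^ 2)%N // !lognX (logn_prime p pp) eqxx; lia.
Qed.

(** * Dirichlet approximation and congruences modulo 4 *)

Lemma dirichlet_approx (y : rat) (T : nat) : (0 < T)%N ->
  exists t : nat, exists c : int, [/\ (0 < t)%N, (t <= T)%N & `|t%:R * y - c%:~R| < T%:R^-1].
Proof.
case: T => // T _.
have T0 : 0 < T.+1%:R :> rat by rewrite ltr0n.
pose r (i : nat) : rat := i%:R * y - (Num.floor (i%:R * y))%:~R.
have r01 i : 0 <= r i < 1.
  have /andP[] := floor_itv (i%:R * y); rewrite rmorphD /= /r; lra.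
(* Pigeonhole: T+2 fractional parts fall into T+1 half-open boxes of length 1/(T+1). Two indices
   sharing a box differ by the wanted t. *)
pose g (i : 'I_T.+2) : 'I_T.+1 := inord `|Num.floor (T.+1%:R * r i)|%N.
have gE (i : 'I_T.+2) : (g i : int) = Num.floor (T.+1%:R * r i).
  have /andP[r0 r1] := r01 i.
  have f0 : 0 <= Num.floor (T.+1%:R * r i).
    by rewrite floor_ge_int ?mulr_ge0 // ltW.
  rewrite /g inordK ?gez0_abs //.
  rewrite -ltz_nat gez0_abs // -(ltr_int rat).
  have /andP[fl _] := floor_itv (T.+1%:R * r i).
  apply: le_lt_trans fl _; rewrite -[X in _ < X]mulr1 ltr_pM2l //.
have [/injectiveP/leq_card|/injectivePn[i [j ij gij]]] := boolP (injectiveb g).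
  by rewrite !card_ord ltnn.
wlog lt_ij : i j ij gij / (i < j)%N.
  move=> H; have := ij; rewrite -val_eqE neq_ltn => /orP[|] lt; first exact: (H i j).
  by apply: (H j i) => //; rewrite eq_sym.
exists (j - i)%N, (Num.floor (j%:R * y) - Num.floor (i%:R * y)).
split; [by rewrite subn_gt0| by have := ltn_ord j; lia|].
have -> : (j - i)%:R * y - (Num.floor (j%:R * y) - Num.floor (i%:R * y))%:~R = r j - r i.
  by rewrite natrB ?(ltnW lt_ij) // rmorphB /= /r; ring.
rewrite -[X in _ < X]mulr1 -ltr_pdivrMl ?invr_gt0 // invrK.
rewrite -[X in X * _]ger0_norm ?(ltW T0) // -normrM mulrBr.
have /andP[] := floor_itv (T.+1%:R * r i); rewrite rmorphD /= -gE gij.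
have /andP[] := floor_itv (T.+1%:R * r j); rewrite rmorphD /= -gE.
rewrite ltr_norml; lra.
Qed.

(** For an integer (u + v sqrt D) / 2 of the field: if D = 1 mod 4 then u^2 = v^2 mod 4, so u and v
    have the same parity. In the next lemma D = 2 mod 4, and u^2 = 2 v^2 mod 4 makes both even. *)
Lemma parity_4d1 (d u v c : int) : u ^+ 2 - (4 * d + 1) * v ^+ 2 = 4 * c -> exists k, u - v = 2 * k.
Proof.
have := divz_eq u 2; have := divz_eq v 2.
have := modz_ge0 u (isT : 2 != 0 :> int); have := ltz_pmod u (isT : 0 < 2 :> int).
have := modz_ge0 v (isT : 2 != 0 :> int); have := ltz_pmod v (isT : 0 < 2 :> int).
move: (u %% 2)%Z (v %% 2)%Z (u %/ 2)%Z (v %/ 2)%Z => r r' a a' h1 h2 h3 h4 Eu Ev E.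
exists (a - a').
have [Er|Er] : r = 0 \/ r = 1 by lia.
  have [Er'|Er'] : r' = 0 \/ r' = 1 by lia.
    lia.
  move: E; rewrite Eu Ev Er Er'; lia.
have [Er'|Er'] : r' = 0 \/ r' = 1 by lia.
  move: E; rewrite Eu Ev Er Er'; lia.
lia.
Qed.

Lemma parity_4d2 (d u v c : int) : u ^+ 2 - (4 * d + 2) * v ^+ 2 = 4 * c ->
  exists a a', u = 2 * a /\ v = 2 * a'.
Proof.
have := divz_eq u 2; have := divz_eq v 2.
have := modz_ge0 u (isT : 2 != 0 :> int); have := ltz_pmod u (isT : 0 < 2 :> int).
have := modz_ge0 v (isT : 2 != 0 :> int); have := ltz_pmod v (isT : 0 < 2 :> int).
move: (u %% 2)%Z (v %% 2)%Z (u %/ 2)%Z (v %/ 2)%Z => r r' a a' h1 h2 h3 h4 Eu Ev E.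
exists a, a'; rewrite Eu Ev in E *.
have [Er|Er] : r = 0 \/ r = 1 by lia.
  have [Er'|Er'] : r' = 0 \/ r' = 1 by lia.
    lia.
  move: E; rewrite Er Er'; lia.
have [Er'|Er'] : r' = 0 \/ r' = 1 by lia.
  move: E; rewrite Er Er'; lia.
move: E; rewrite Er Er'; lia.
Qed.

(** * Elements, norms and integers of Q(sqrt D) *)

Section QuadraticField.
Variable D : nat.
Hypotheses (D_gt1 : (1 < D)%N) (D_sqf : squarefree D).

Definition qelt (x y : rat) : algC := ratr x + ratr y * sqrtC D%:R.
Definition qnorm (x y : rat) : rat := x ^+ 2 - D%:R * y ^+ 2.

Lemma sqr_sqrtD : sqrtC D%:R ^+ 2 = ratr D%:R :> algC.
Proof. by rewrite sqrtCK ratr_nat. Qed.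

Lemma qeltD x y x' y' : qelt x y + qelt x' y' = qelt (x + x') (y + y').
Proof. rewrite /qelt !rmorphD /=; ring. Qed.

Lemma qeltB x y x' y' : qelt x y - qelt x' y' = qelt (x - x') (y - y').
Proof. rewrite /qelt !rmorphB /=; ring. Qed.

Lemma qeltM x y x' y' :
  qelt x y * qelt x' y' = qelt (x * x' + D%:R * y * y') (x * y' + y * x').
Proof.
have -> : qelt x y * qelt x' y' =
    ratr x * ratr x' + sqrtC D%:R ^+ 2 * ratr y * ratr y' +
    (ratr x * ratr y' + ratr y * ratr x') * sqrtC D%:R.
  by rewrite /qelt; ring.
by rewrite sqr_sqrtD /qelt !(rmorphD, rmorphM) /=.
Qed.

Lemma qelt_rat x : qelt x 0 = ratr x.
Proof. by rewrite /qelt rmorph0 mul0r addr0. Qed.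

Lemma qelt_nat n : qelt n%:R 0 = n%:R.
Proof. by rewrite qelt_rat ratr_nat. Qed.

Lemma qnormM x y x' y' :
  qnorm (x * x' + D%:R * y * y') (x * y' + y * x') = qnorm x y * qnorm x' y'.
Proof. rewrite /qnorm; ring. Qed.

(** The squared denominator of y is coprime to the squared numerator, so it divides D. *)
Lemma sqfree_int_sqr (y : rat) : D%:R * y ^+ 2 \is a Num.int -> y \is a Num.int.
Proof.
move=> /intrP[c Ec].
have E : D%:R * numq y ^+ 2 = c * denq y ^+ 2 :> int.
  apply/eqP; rewrite -(eqr_int rat) !(rmorphM, rmorphXn) /= -Ec rmorph_nat.
  by rewrite numqE exprMn mulrA.
have dvd : (`|denq y| ^ 2 %| D * `|numq y| ^ 2)%N.
  have := congr1 absz E; rewrite !abszM natz absz_nat -!mulnn => ->.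
  by rewrite dvdn_mull.
rewrite Gauss_dvdl in dvd; last first.
  by rewrite coprimeXl // coprimeXr // coprime_sym coprime_num_den.
have d1 : `|denq y|%N = 1%N by apply: D_sqf; rewrite mulnn.
by rewrite Qint_def -absz_denq d1.
Qed.

Lemma D_not_sqr (x : rat) : x ^+ 2 != D%:R.
Proof.
apply/eqP => E.
have D0 : D%:R != 0 :> rat by rewrite pnatr_eq0 -lt0n (ltnW D_gt1).
have x0 : x != 0 by apply: contraNneq D0 => x0; rewrite -E x0 expr0n.
(* The inverse of x is the useful argument for [sqfree_int_sqr]: it becomes an integer c with D c^2
   = 1, against D > 1. *)
have E1 : D%:R * (x^-1) ^+ 2 = 1 by rewrite -E exprVn mulfV ?expf_neq0.
have : x^-1 \is a Num.int by apply: sqfree_int_sqr; rewrite E1.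
move=> /intrP[c Ec].
have : D%:R * c ^+ 2 = 1 :> int.
  by apply/eqP; rewrite -(eqr_int rat) !(rmorphM, rmorphXn) /= -Ec rmorph_nat E1.
move=> /(congr1 absz); rewrite abszM natz absz_nat => /eqP.
rewrite muln_eq1 => /andP[/eqP D1 _]; move: D_gt1; by rewrite D1.
Qed.

Lemma qnorm_eq0 x y : (qnorm x y == 0) = (x == 0) && (y == 0).
Proof.
apply/idP/andP => [|[/eqP-> /eqP->]]; last by rewrite /qnorm expr0n mulr0 subrr.
rewrite /qnorm subr_eq0 => /eqP E.
have [y0|y0] := eqVneq y 0.
  by move: E; rewrite y0 expr0n /= mulr0 => /eqP; rewrite sqrf_eq0.
have := D_not_sqr (x / y).
by rewrite expr_div_n E mulfK ?expf_neq0 // eqxx.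
Qed.

Lemma qelt_eq0 x y : (qelt x y == 0) = (x == 0) && (y == 0).
Proof.
rewrite -qnorm_eq0; apply/eqP/eqP => E.
  have : qelt x y * qelt x (- y) = 0 by rewrite E mul0r.
  rewrite qeltM (_ : x * - y + y * x = 0); last by ring.
  rewrite qelt_rat => /eqP; rewrite fmorph_eq0 => /eqP <-.
  by rewrite /qnorm; ring.
move/eqP: E; rewrite qnorm_eq0 => /andP[/eqP-> /eqP->].
by rewrite qelt_rat rmorph0.
Qed.

Lemma qelt_inj x y x' y' : qelt x y = qelt x' y' -> x = x' /\ y = y'.
Proof.
move/eqP; rewrite -subr_eq0 qeltB qelt_eq0 !subr_eq0.
by case/andP => /eqP-> /eqP->.
Qed.

Lemma qnorm_of_mul x y x1 y1 x2 y2 :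
  qelt x y = qelt x1 y1 * qelt x2 y2 -> qnorm x y = qnorm x1 y1 * qnorm x2 y2.
Proof. by rewrite qeltM => /qelt_inj[-> ->]; rewrite qnormM. Qed.

Lemma qelt_div x y x' y' : qelt x' y' != 0 ->
  exists X Y, qelt x y = qelt X Y * qelt x' y'.
Proof.
rewrite qelt_eq0 -qnorm_eq0 => N0.
exists ((x * x' - D%:R * y * y') / qnorm x' y'), ((y * x' - x * y') / qnorm x' y').
by rewrite qeltM; congr qelt; move: N0; rewrite /qnorm => N0; field.
Qed.

(** The characteristic polynomial X^2 - trace X + norm. *)
Definition qpoly (x y : rat) : {poly rat} := 'X ^+ 2 + (- (2 * x))%:P * 'X + (qnorm x y)%:P.

Lemma polyseq_qpoly x y : qpoly x y = [:: qnorm x y; - (2 * x); 1] :> seq rat.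
Proof.
have l1 : last 0 [:: qnorm x y; - (2 * x); 1] != 0 by rewrite oner_eq0.
rewrite -(PolyK l1) /qpoly /= !cons_poly_def polyC1.
by congr polyseq; ring.
Qed.

Lemma qpoly_monic x y : qpoly x y \is monic.
Proof. by apply/monicP; rewrite /lead_coef polyseq_qpoly. Qed.

Lemma root_qpoly x y : root (map_poly ratr (qpoly x y)) (qelt x y).
Proof.
rewrite /root /qpoly 2!rmorphD /= rmorphXn rmorphM /= !map_polyC map_polyX !hornerE /=.
rewrite expr2 -!qelt_rat !(qeltM, qeltD) qelt_eq0 /qnorm.
by apply/andP; split; apply/eqP; ring.
Qed.

(** The minimal polynomial divides [qpoly], and it is not linear, since y != 0 keeps the element out
    of Q. *)
Lemma minCpoly_qelt x y : y != 0 ->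
  minCpoly (qelt x y) = map_poly ratr (qpoly x y).
Proof.
move=> y0; have [p [Ep p_monic] pP] := minCpolyP (qelt x y).
have sq : size (qpoly x y) = 3%N by rewrite polyseq_qpoly.
have qp : p %| qpoly x y by rewrite -pP root_qpoly.
have p2 : (1 < size p)%N by have := size_minCpoly (qelt x y); rewrite Ep size_map_poly.
have p3 : (size p <= 3)%N by rewrite -sq dvdp_leq // -size_poly_gt0 sq.
have s2 : size p != 2%N.
  apply/negP => /eqP s2.
  have := root_minCpoly (qelt x y); rewrite Ep.
  have -> : p = 'X + (p`_0)%:P.
    have p1 : p`_1 = 1 by move/monicP: p_monic; rewrite /lead_coef s2.
    apply/polyP => i; rewrite coefD coefX coefC.
    case: i => [|[|i]]; rewrite ?add0r ?addr0 ?p1 //=.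
    by rewrite nth_default ?s2.
  rewrite rmorphD /= map_polyX map_polyC /root !hornerE /= -qelt_rat qeltD qelt_eq0 /=.
  by rewrite addr0 (negPf y0) andbF.
rewrite Ep; congr map_poly.
apply/eqP; rewrite -eqp_monic ?qpoly_monic // -dvdp_size_eqp // sq.
by case: (size p) p2 p3 s2 => [|[|[|[|]]]].
Qed.

Lemma Aint_qelt x y :
  (qelt x y \in Aint) = (2 * x \is a Num.int) && (qnorm x y \is a Num.int).
Proof.
apply/idP/andP => [|[tr_int nm_int]].
  have [->|y0] := eqVneq y 0.
    rewrite qelt_rat => A.
    have := Cint_rat_Aint (Crat_rat x) A.
    rewrite Cint_rat => xi; rewrite /qnorm expr0n mulr0 subr0.
    by split; [rewrite rpredM|rewrite rpredX].
  rewrite unfold_in minCpoly_qelt // => /polyOverP H.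
  have := H 0%N; have := H 1%N.
  by rewrite !coef_map polyseq_qpoly /= !Cint_rat rpredN.
apply: (@root_monic_Aint (map_poly ratr (qpoly x y))).
- exact: root_qpoly.
- by rewrite map_monic qpoly_monic.
apply/polyOverP => i; rewrite coef_map Cint_rat polyseq_qpoly.
by case: i => [|[|[|i]]] //=; rewrite ?rpredN ?nth_nil.
Qed.

Lemma quad_int_qnorm x y : quad_int D (qelt x y) -> qnorm x y \is a Num.int.
Proof. by case=> _; rewrite Aint_qelt => /andP[]. Qed.

Lemma quad_intP z : quad_int D z <->
  exists u v c : int, z = qelt (u%:~R / 2) (v%:~R / 2) /\ u ^+ 2 - D%:Z * v ^+ 2 = 4 * c.
Proof.
have cast (u v c : int) : qnorm (u%:~R / 2) (v%:~R / 2) = c%:~R ->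
    u ^+ 2 - D%:Z * v ^+ 2 = 4 * c.
  rewrite /qnorm => E; apply/eqP; rewrite -(eqr_int rat) !(rmorphB, rmorphM) /= -pmulrn.
  by rewrite -E; apply/eqP; field.
split=> [[[x [y ->]]]|[u [v [c [-> E]]]]].
  rewrite Aint_qelt => /andP[/intrP[u Eu] /intrP[c Ec]].
  (* D (2y)^2 = (2x)^2 - 4 N is an integer, so squarefreeness of D applies to 2y. *)
  have /intrP[v Ev] : 2 * y \is a Num.int.
    apply: sqfree_int_sqr.
    have -> : D%:R * (2 * y) ^+ 2 = (2 * x) ^+ 2 - 4 * qnorm x y by rewrite /qnorm; ring.
    by rewrite Eu Ec rpredB ?rpredM ?rpredX ?intr_int.
  have Ex : x = u%:~R / 2 by rewrite -Eu; field.
  have Ey : y = v%:~R / 2 by rewrite -Ev; field.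
  exists u, v, c; split; first by rewrite Ex Ey.
  by apply: cast; rewrite -Ex -Ey.
split; first by exists (u%:~R / 2), (v%:~R / 2).
rewrite Aint_qelt; apply/andP; split.
  have -> : 2 * (u%:~R / 2) = u%:~R :> rat by field.
  exact: intr_int.
suff -> : qnorm (u%:~R / 2) (v%:~R / 2) = c%:~R by exact: intr_int.
have := congr1 (fun a : int => a%:~R : rat) E.
rewrite !(rmorphB, rmorphM) /= -pmulrn -!expr2 => {}E.
have -> : qnorm (u%:~R / 2) (v%:~R / 2) = (u%:~R ^+ 2 - D%:R * v%:~R ^+ 2) / 4.
  by rewrite /qnorm; field.
by rewrite E; field.
Qed.

Lemma quad_intD z w : quad_int D z -> quad_int D w -> quad_int D (z + w).
Proof.
move=> [[x [y ->]] iz] [[x' [y' ->]] iw]; split; last exact: rpredD.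
by exists (x + x'), (y + y'); rewrite qeltD.
Qed.

Lemma quad_intM z w : quad_int D z -> quad_int D w -> quad_int D (z * w).
Proof.
move=> [[x [y ->]] iz] [[x' [y' ->]] iw]; split; last exact: rpredM.
by exists (x * x' + D%:R * y * y'), (x * y' + y * x'); rewrite qeltM.
Qed.

Lemma quad_int_qelt (a b : int) : quad_int D (qelt a%:~R b%:~R).
Proof.
split; first by exists a%:~R, b%:~R.
rewrite Aint_qelt /qnorm; apply/andP; split.
  by rewrite rpredM ?intr_int.
by rewrite rpredB ?rpredM ?rpredX ?rpred_nat ?intr_int.
Qed.

Lemma quad_int_int (a : int) : quad_int D a%:~R.
Proof. by have := quad_int_qelt a 0; rewrite qelt_rat ratr_int. Qed.

(** * Ideal classes and finiteness of the class group *)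

Lemma ideal_equiv_refl I : ideal_equiv D I I.
Proof.
have q1 : quad_int D 1 by rewrite -[1]/(1%:~R); exact: quad_int_int.
by exists 1, 1; split; rewrite ?oner_eq0.
Qed.

Lemma ideal_equiv_sym I J : ideal_equiv D I J -> ideal_equiv D J I.
Proof. by move=> [a [c [? ? ? ? E]]]; exists c, a; split. Qed.

Lemma ideal_equiv_trans J I L : ideal_equiv D I J -> ideal_equiv D J L -> ideal_equiv D I L.
Proof.
move=> [a [c [ia ic a0 c0 E]]] [a' [c' [ia' ic' a0' c0' E']]].
exists (a * a'), (c * c'); split; rewrite ?mulf_neq0 //; try exact: quad_intM.
have scale (e e' : algC) A : [set e * e' * x | x in A] = [set e' * y | y in [set e * x | x in A]].
  by rewrite image_comp; apply: eq_imagel => x _ /=; rewrite mulrCA mulrA.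
by rewrite scale E -scale [c * a']mulrC scale E' -scale [c' * c]mulrC.
Qed.

Lemma ideal_class_eq I J : ideal_equiv D I J -> ideal_class D I = ideal_class D J.
Proof.
move=> IJ; apply/seteqP; split=> L [L0 E]; split=> //.
  exact: ideal_equiv_trans (ideal_equiv_sym IJ) E.
exact: ideal_equiv_trans IJ E.
Qed.

(* Only the coordinate y has to be approximated, up to 1 / D: for x it is enough
   to subtract the integer part, since the norm x ^ 2 - D y ^ 2 is indefinite. *)
Lemma near_quad_int (x y : rat) : exists t : nat, exists a c : int,
  [/\ (0 < t)%N, (t <= D)%N & `|qnorm (t%:R * x - a%:~R) (t%:R * y - c%:~R)| < 1].
Proof.
have [t [c [t0 tD h]]] := dirichlet_approx y (ltnW D_gt1).
exists t, (Num.floor (t%:R * x)), c; split=> //.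
have := floor_itv (t%:R * x); rewrite rmorphD /= => /andP[].
set r := t%:R * y - _ in h *.
set f := (Num.floor _)%:~R => f0 f1.
have D1 : 1 < D%:R :> rat by rewrite ltr1n.
have rD : D%:R * `|r| < 1 by rewrite mulrC -ltr_pdivlMr ?div1r // (lt_trans ltr01).
have r2 : 0 <= D%:R * r ^+ 2 < 1.
  rewrite mulr_ge0 ?sqr_ge0 ?ler0n //=.
  have r0 := normr_ge0 r.
  have -> : r ^+ 2 = `|r| ^+ 2 by rewrite real_normK ?num_real.
  nra.
have x2 : 0 <= (t%:R * x - f) ^+ 2 < 1 by apply/andP; split; [exact: sqr_ge0|nra].
by rewrite /qnorm ltr_norml; lra.
Qed.

Lemma quad_int_abs_qnorm x y : quad_int D (qelt x y) -> exists m : nat, `|qnorm x y| = m%:R.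
Proof.
move=> /quad_int_qnorm /intrP[c ->]; exists `|c|%N.
by rewrite natr_absz intr_norm.
Qed.

Lemma nonzero_ideal_scale (I : set algC) (m b : algC) : nonzero_ideal D I ->
  m != 0 -> b != 0 -> (forall x, I x -> quad_int D (m * x / b)) ->
  nonzero_ideal D [set m * x / b | x in I].
Proof.
move=> [_ [x Ix x0] ID IM] m0 b0 h; split.
- by move=> _ [y Iy <-]; exact: h.
- by exists (m * x / b); [exists x|rewrite !mulf_neq0 ?invr_eq0].
- by move=> _ _ [y Iy <-] [z Iz <-]; exists (y + z); [exact: ID|ring].
- by move=> a _ qa [y Iy <-]; exists (a * y); [exact: IM|ring].
Qed.

(** The ideal J is (D! / b) I, where b is a nonzero element of I of least absolute norm; b itself
    goes to D!. *)
Lemma ideal_contains_factorial (I : set algC) : nonzero_ideal D I ->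
  exists J : set algC, [/\ nonzero_ideal D J, J (D`!%:R) & ideal_equiv D I J].
Proof.
move=> I_ideal; have [IO [w Iw w0] ID IM] := I_ideal.
pose P n := `[< exists x y, [/\ I (qelt x y), qelt x y != 0 & `|qnorm x y| = n%:R] >].
have exP : exists n, P n.
  have [[x [y Ew]] _] := IO _ Iw; rewrite -/(qelt x y) in Ew.
  have [|m Em] := @quad_int_abs_qnorm x y; first by rewrite -Ew; exact: IO.
  by exists m; apply/asboolP; exists x, y; rewrite -Ew.
case: (ex_minnP exP) => n /asboolP[x0 [y0 [Ib b0 Nb]]] n_min.
set b := qelt x0 y0 in Ib b0.
have n0 : 0 < n%:R :> rat.
  by rewrite -Nb normr_gt0 qnorm_eq0 -qelt_eq0.
have ib := IO _ Ib.
have M0 : D`!%:R != 0 :> algC by rewrite pnatr_eq0 -lt0n fact_gt0.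
have dvd z : I z -> quad_int D (D`!%:R * z / b).
  move=> Iz; have [[x [y Ez]] _] := IO _ Iz; rewrite -/(qelt x y) in Ez.
  have [X [Y EXY]] := qelt_div x y b0.
  have [t [a [c [t0 tD small]]]] := near_quad_int X Y.
  pose om := qelt a%:~R c%:~R.
  have iom : quad_int D om by exact: quad_int_qelt.
  pose d := qelt (t%:R * X - a%:~R) (t%:R * Y - c%:~R).
  have Ed : t%:R * z - om * b = d * b.
    rewrite Ez EXY /d -qeltB -/om; rewrite mulrBl; congr (_ - _).
    by rewrite mulrA -qelt_nat qeltM; congr (qelt _ _ * _); ring.
  have Id : I (d * b).
    rewrite -Ed; apply: ID.
      by apply: IM => //; exact: (quad_int_int t).
    rewrite -mulN1r mulrA; apply: IM => //; apply: quad_intM => //.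
    by rewrite -[-1]/((-1)%:~R); exact: quad_int_int.
  (* t z - [om] b lies in I and its norm is smaller than that of b, so minimality kills it. *)
  have d0 : d * b = 0.
    apply/eqP/negPn/negP => db0.
    have Edb := qeltM (t%:R * X - a%:~R) (t%:R * Y - c%:~R) x0 y0.
    rewrite -/d -/b in Edb; rewrite Edb in Id db0.
    have [m Em] := quad_int_abs_qnorm (IO _ Id).
    have Pm : P m by apply/asboolP; do 2 eexists; split; [exact: Id|exact: db0|exact: Em].
    move: (n_min m Pm); apply/negP; rewrite -ltnNge -(ltr_nat rat) -Em qnormM normrM Nb.
    by rewrite -[X in _ < X]mul1r ltr_pM2r.
  have Etz : t%:R * z = om * b by apply/eqP; rewrite -subr_eq0 Ed d0.
  (* The multiplier t depends on z, but t <= D, so D! serves all z at once. *)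
  have tM : (t %| D`!)%N by rewrite dvdn_fact // t0.
  have -> : D`!%:R * z / b = (D`! %/ t)%:R * om.
    rewrite -{1}(divnK tM) natrM -[_ * t%:R * z]mulrA Etz; field; exact: b0.
  by apply: quad_intM => //; exact: (quad_int_int (D`! %/ t)%N).
exists [set D`!%:R * x / b | x in I]; split.
- exact: nonzero_ideal_scale.
- by exists b => //; rewrite mulfK.
exists D`!%:R, b; split => //; first exact: (quad_int_int D`!).
apply/seteqP; split=> [_ [x Ix <-]|_ [_ [x Ix <-] <-]].
  by exists (D`!%:R * x / b); [exists x|field; exact: b0].
by exists x => //; field; exact: b0.
Qed.

(** An ideal J containing M = D! is a union of cosets of M Z[sqrt D]. Its elements are (u + v sqrt
    D) / 2, so J is determined by the pairs (u, v) modulo 2M that occur, and there are finitely many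
    sets of such pairs. *)
Lemma class_group_finite : finite_set (class_group D).
Proof.
set M := D`!; have M0 : (0 < M)%N by exact: fact_gt0.
pose gen (S : {set 'I_(2 * M) * 'I_(2 * M)}) : set algC := [set z | exists i j (a c : int),
  (i, j) \in S /\ z = qelt (i%:R / 2 + M%:R * a%:~R) (j%:R / 2 + M%:R * c%:~R)].
apply: (@sub_finite_set _ _ ([set ideal_class D (gen S) | S in [set: {set 'I_(2 * M) * 'I_(2 * M)}]])); last first.
  exact/finite_image/finite_finset.
move=> _ [I I0 <-].
have [J [J0 JM IJ]] := ideal_contains_factorial I0.
have [JO _ JD JMul] := J0.
exists (finset (fun ij : 'I_(2 * M) * 'I_(2 * M) => `[< J (qelt (ij.1%:R / 2) (ij.2%:R / 2)) >])) => //.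
rewrite (ideal_class_eq IJ); congr ideal_class.
have JMac (a c : int) : J (qelt (M%:R * a%:~R) (M%:R * c%:~R)).
  have -> : qelt (M%:R * a%:~R) (M%:R * c%:~R) = qelt a%:~R c%:~R * M%:R.
    by rewrite -qelt_nat qeltM; congr qelt; ring.
  by apply: JMul => //; exact: quad_int_qelt.
apply/seteqP; split=> [z [i [j [a [c [/= ]]]]]|z Jz].
  rewrite inE /= => /asboolP Jij ->.
  by rewrite -qeltD; exact: JD.
have /quad_intP[u [v [_ [Ez _]]]] := JO _ Jz.
have M20 : (0 < 2 * M)%N by rewrite muln_gt0.
have digits (w : int) : exists i : 'I_(2 * M), exists a : int,
    w%:~R / 2 = i%:R / 2 + M%:R * a%:~R :> rat.
  have lt : (`|(w %% (2 * M)%N)%Z|%N < 2 * M)%N.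
    by have := ltz_pmod w (_ : 0 < (2 * M)%N%:Z); have := modz_ge0 w (_ : (2 * M)%N%:Z != 0); lia.
  exists (Ordinal lt), (w %/ (2 * M)%N)%Z => /=.
  rewrite {1}(divz_eq w (2 * M)%N) natr_absz ger0_norm; last by apply: modz_ge0; lia.
  by rewrite rmorphD rmorphM /= -pmulrn natrM; field.
have [i [a Eu]] := digits u; have [j [c Ev]] := digits v.
exists i, j, a, c; split; last by rewrite Ez Eu Ev.
rewrite inE /=; apply/asboolP.
have -> : qelt (i%:R / 2) (j%:R / 2) = z + qelt (M%:R * (- a)%:~R) (M%:R * (- c)%:~R).
  by rewrite Ez Eu Ev qeltD !rmorphN /=; congr qelt; ring.
exact: JD.
Qed.

(** Write O for the ring of integers. If a O = c I, then a = c g with g in I, and g generates I; so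
    I and O have distinct classes. Finiteness ensures that [fset_set] retains them. *)
Lemma class_number_gt1 (I : set algC) : nonzero_ideal D I ->
  (forall g, I g -> [set g * w | w in quad_int D] <> I) -> (1 < class_number D)%N.
Proof.
move=> I_ideal nprinc.
have q1 : quad_int D 1 by rewrite -[1]/(1%:~R); exact: quad_int_int.
have O_ideal : nonzero_ideal D (quad_int D).
  split=> //; first by exists 1; rewrite ?oner_eq0.
    exact: quad_intD.
  exact: quad_intM.
have neq : ideal_class D (quad_int D) != ideal_class D I.
  apply/eqP => E.
  have : ideal_class D I I by split=> //; exact: ideal_equiv_refl.
  rewrite -E => -[_ [a [c [qa qc a0 c0 EI]]]].
  have : [set a * x | x in quad_int D] a by exists 1; rewrite ?mulr1.
  rewrite EI => -[g Ig Ea].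
  apply: (nprinc _ Ig); apply/seteqP; split=> [_ [w qw <-]|z Iz].
    have [_ _ _ IM] := I_ideal.
    by rewrite mulrC; exact: IM.
  have : [set c * x | x in I] (c * z) by exists z.
  rewrite -EI => -[w qw Ew]; exists w => //.
  by apply: (mulfI c0); rewrite mulrA Ea.
rewrite /class_number.
have -> : 2%N = #|` [fset ideal_class D (quad_int D); ideal_class D I]%fset|.
  by rewrite cardfs2 neq.
apply: fsubset_leq_card; apply/fsubsetP => A.
rewrite !inE in_fset_set; last exact: class_group_finite.
by case/orP => /eqP->; rewrite inE; [exists (quad_int D)|exists I].
Qed.

Lemma quad_int_coords u v : quad_int D (qelt (u%:~R / 2) (v%:~R / 2)) ->
  exists c, u ^+ 2 - D%:Z * v ^+ 2 = 4 * c.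
Proof.
move=> /quad_intP[u' [v' [c [/qelt_inj[Eu Ev] E]]]]; exists c.
have inj (w w' : int) : w%:~R / 2 = w'%:~R / 2 :> rat -> w = w'.
  by move/(mulIf (isT : (2^-1 : rat) != 0)) => /eqP; rewrite eqr_int => /eqP.
by rewrite (inj _ _ Eu) (inj _ _ Ev).
Qed.

(** * A prime ideal above a split prime p, and when it is not principal *)

Section SplitPrime.
Variable p : nat.
Hypothesis p_prime : prime p.
(** Either way D = 1 mod p, and D = 1 mod 8 if p = 2, so p splits. The two cases are D = 1 and D = 2
    mod 4. *)
Hypothesis D_split : (exists d, D = 4 * p * d + 1)%N \/
  [/\ odd p, (exists d, D = p * d + 1)%N & (exists d, D = 4 * d + 2)%N].

(* The prime above p where sqrt D is congruent to 1. *)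
Definition prime_above : set algC := [set z | quad_int D z /\
  exists u v w : int, z = qelt (u%:~R / 2) (v%:~R / 2) /\ u + v = 2 * p%:Z * w].

Lemma split_coords (u v c : int) : u ^+ 2 - D%:Z * v ^+ 2 = 4 * c ->
  exists k, u - v = 2 * k.
Proof.
case: D_split => [[d Ed]|[_ _ [d Ed]]] E.
  by apply: (@parity_4d1 (p%:Z * d) _ _ c); rewrite -E Ed; lia.
have [|a [a' [-> ->]]] := @parity_4d2 d u v c; first by rewrite -E Ed; lia.
by exists (a - a'); ring.
Qed.

(** Controls the failure of u + v to be multiplicative. In the second case p divides D - 1 and the
    factor 4 comes from v and v' being even. *)
Lemma split_disc (u v c u' v' c' : int) :
  u ^+ 2 - D%:Z * v ^+ 2 = 4 * c -> u' ^+ 2 - D%:Z * v' ^+ 2 = 4 * c' ->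
  exists l, (D%:Z - 1) * v * v' = 4 * p%:Z * l.
Proof.
case: D_split => [[d Ed] _ _|[_ [d Ed] [d' Ed']] E E'].
  by exists (d%:Z * v * v'); rewrite Ed; lia.
have [|a [b [_ ->]]] := @parity_4d2 d' u v c; first by rewrite -E Ed'; lia.
have [|a' [b' [_ ->]]] := @parity_4d2 d' u' v' c'; first by rewrite -E' Ed'; lia.
by exists (d%:Z * b * b'); rewrite Ed; lia.
Qed.

Lemma prime_above_p : prime_above p%:R.
Proof.
split; first exact: (quad_int_int p).
exists (2 * p%:Z), 0, 1; split; last by ring.
by rewrite -qelt_nat; congr qelt; rewrite intrM -pmulrn; field.
Qed.

Lemma prime_above_ideal : nonzero_ideal D prime_above.
Proof.
split.
- by move=> z [].
- exists p%:R; last by rewrite pnatr_eq0 -lt0n prime_gt0. exact: prime_above_p.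
- move=> z z' [qz [u [v [w [Ez E]]]]] [qz' [u' [v' [w' [Ez' E']]]]].
  split; first exact: quad_intD.
  exists (u + u'), (v + v'), (w + w'); split; last by lia.
  by rewrite Ez Ez' qeltD !rmorphD /=; congr qelt; ring.
move=> z z' qz [qz' [u' [v' [w' [Ez' E']]]]]; split; first exact: quad_intM.
have [u [v [c [Ez Ec]]]] := proj1 (quad_intP z) qz.
have [|c' Ec'] := @quad_int_coords u' v'; first by rewrite -Ez'.
have /quad_intP[U [V [C [EU EC]]]] := quad_intM qz qz'.
have [k Ek] := split_coords Ec; have [l El] := split_disc Ec Ec'.
exists U, V, ((v + k) * w' + l); split=> //.
move: (EU); rewrite Ez Ez' qeltM => /qelt_inj[EU1 EV1].
(* On the right, u + v is even and u' + v' is a multiple of 2p, so with [split_disc] both terms are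
   multiples of 4p. *)
suff : (2 * (U + V))%:~R = ((u + v) * (u' + v') + (D%:Z - 1) * v * v')%:~R :> rat.
  move/eqP; rewrite eqr_int => /eqP; rewrite El E'.
  have -> : u = v + 2 * k by lia.
  lia.
rewrite !(rmorphM, rmorphD, rmorphB) /= -!pmulrn.
have -> : U%:~R = 2 * (U%:~R / 2) :> rat by field.
have -> : V%:~R = 2 * (V%:~R / 2) :> rat by field.
by rewrite -EU1 -EV1; field.
Qed.

Lemma qnorm_half (u v c : int) : u ^+ 2 - D%:Z * v ^+ 2 = 4 * c ->
  qnorm (u%:~R / 2) (v%:~R / 2) = c%:~R.
Proof.
move/(congr1 (fun a : int => a%:~R : rat)).
rewrite !(rmorphB, rmorphM) /= -pmulrn -!expr2 => E.
have -> : qnorm (u%:~R / 2) (v%:~R / 2) = (u%:~R ^+ 2 - D%:R * v%:~R ^+ 2) / 4.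
  by rewrite /qnorm; field.
by rewrite E; field.
Qed.

(** Serves to show that the ideal is larger than (p). The element is (1 - sqrt D) / 2 when D = 1 mod
    4 and 1 - sqrt D when D = 2 mod 4. *)
Lemma small_prime_above : exists e : nat, ~~ (p %| e)%N /\
  prime_above (qelt (e%:~R / 2) ((- e%:Z)%:~R / 2)).
Proof.
have [e [pe [c Ec]]] : exists e : nat, ~~ (p %| e)%N /\
    exists c, e%:Z ^+ 2 - D%:Z * (- e%:Z) ^+ 2 = 4 * c.
  case: D_split => [[d ->]|[p_odd _ _]].
    exists 1%N; split; first by rewrite dvdn1 neq_ltn prime_gt1 ?orbT.
    by exists (- (p * d)%N%:Z); lia.
  exists 2%N; split; last by exists (1 - D%:Z); ring.
  by rewrite dvdn_prime2 //; apply: contraTneq p_odd => ->.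
exists e; split=> //; split; last by exists e, (- e%:Z), 0; split=> //; lia.
by apply/quad_intP; exists e, (- e%:Z), c.
Qed.

(** A generator g divides p, so its norm c divides p^2. As p divides c, |c| is p or p^2; the first
    is excluded by assumption, and the second would make the ideal equal to (p). *)
Lemma prime_above_not_principal g :
  (forall x y : int, `|x ^+ 2 - D%:Z * y ^+ 2| <> (4 * p)%N) ->
  prime_above g -> [set g * w | w in quad_int D] <> prime_above.
Proof.
move=> no_norm [qg [u [v [w [Eg Euv]]]]] princ.
have [|c Ec] := @quad_int_coords u v; first by rewrite -Eg.
(* 4c = (u + v)(u - v) - (D - 1) v^2, and both terms are multiples of 4p. *)
have [m Em] : exists m, c = p%:Z * m.
  have [k Ek] := split_coords Ec; have [l El] := split_disc Ec Ec.
  exists (w * k - l).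
  have : 4 * c = (u + v) * (u - v) - (D%:Z - 1) * v * v by rewrite -Ec; ring.
  rewrite Euv Ek El; lia.
have : [set g * w | w in quad_int D] p%:R by rewrite princ; exact: prime_above_p.
case=> w1 qw1 Ew1; have [u1 [v1 [c1 [E1 Ec1]]]] := proj1 (quad_intP w1) qw1.
have Ecc : c * c1 = p%:Z ^+ 2.
  apply/eqP; rewrite -(eqr_int rat) rmorphM rmorphXn /= -(qnorm_half Ec) -(qnorm_half Ec1).
  rewrite -(@qnorm_of_mul p%:R 0); first by rewrite /qnorm -pmulrn; apply/eqP; ring.
  by rewrite -Eg -E1 Ew1 qelt_nat.
have : (`|c| %| p ^ 2)%N.
  by rewrite -mulnn; have := congr1 absz Ecc; rewrite expr2 !abszM absz_nat => <-; rewrite dvdn_mulr.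
move/(dvdn_pfactor _ _ p_prime) => [[|[|[|//]]] _ Ei].
- move: Ei; rewrite Em abszM => /eqP; rewrite expn0 muln_eq1 => /andP[/eqP p1 _].
  by move: p_prime; rewrite /= in p1; rewrite p1.
- apply: (no_norm u v); rewrite Ec normrM -(abszE c) Ei; lia.
(* Now |c| = p^2, so w1 = p / g has norm c1 = 1 or -1 and inverse c1 times its conjugate [cw]. Hence
   every multiple of g is a multiple of p, and p would divide e. *)
have [e [pe Ie]] := small_prime_above.
have : [set g * w | w in quad_int D] (qelt (e%:~R / 2) ((- e%:Z)%:~R / 2)) by rewrite princ.
case=> w2 qw2 Ew2.
have p0 : p%:Z != 0 by rewrite eqz_nat -lt0n prime_gt0.
have c1_unit : c1 * c1 = 1.
  have : `|c1|%N = 1%N.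
    have := congr1 absz Ecc; rewrite expr2 !abszM absz_nat Ei -mulnn => /eqP.
    by rewrite -{2}[(p * p)%N]muln1 eqn_pmul2l ?muln_gt0 ?prime_gt0 // => /eqP.
  lia.
pose cw := qelt (u1%:~R / 2) ((- v1)%:~R / 2).
have qcw : quad_int D cw by apply/quad_intP; exists u1, (- v1), c1; split=> //; rewrite -Ec1; ring.
have Ew1cw : w1 * cw = c1%:~R.
  have -> : c1%:~R = qelt c1%:~R 0 by rewrite qelt_rat ratr_int.
  rewrite E1 qeltM -(qnorm_half Ec1).
  by congr qelt; rewrite /qnorm ?rmorphN /=; ring.
have qw3 : quad_int D (c1%:~R * cw * w2).
  by apply: quad_intM => //; apply: quad_intM => //; exact: quad_int_int.
have Ew3 : qelt (e%:~R / 2) ((- e%:Z)%:~R / 2) = p%:R * (c1%:~R * cw * w2).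
  rewrite -Ew1 -Ew2.
  have -> : g * w1 * (c1%:~R * cw * w2) = g * w2 * (c1%:~R * (w1 * cw)) by ring.
  by rewrite Ew1cw -rmorphM c1_unit mulr1.
have /quad_intP[u3 [v3 [c3 [E3 _]]]] := qw3.
move: Ew3; rewrite E3 -qelt_nat qeltM => /qelt_inj[Ee _].
have Eep : e%:Z = p%:Z * u3.
  apply/eqP; rewrite -(eqr_int rat) rmorphM /=; apply/eqP.
  have -> : e%:~R = 2 * (e%:~R / 2) :> rat by field.
  by rewrite Ee -pmulrn; field.
move/negP: pe; apply; have := congr1 absz Eep; rewrite abszM /= => ->.
by rewrite dvdn_mulr.
Qed.

End SplitPrime.

End QuadraticField.

(* Choice of p, and conclusion *)
Local Close Scope ring_scope.
Local Close Scope classical_set_scope.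

(** The condition gcd(b, s) > 2 enters here: for g = 1 there is no prime, and for g = 2 only p = 2,
    without 4 dividing g. *)
Lemma exists_split_prime (g : nat) : 2 < g ->
  exists p, [/\ prime p, p %| g & odd p || (p == 2) && (4 %| g)].
Proof.
move=> g_gt2; have [g_odd|g_even] := boolP (odd g).
  exists (pdiv g); rewrite pdiv_prime ?pdiv_dvd ?(ltnW g_gt2) //.
  by rewrite (dvdn_odd (pdiv_dvd g)).
have [h Eg] : exists h, g = 2 * h by exists g./2; rewrite mul2n even_halfK.
have [h_odd|h_even] := boolP (odd h).
  have h_gt1 : 1 < h by move: g_gt2 h_odd; rewrite Eg; case: h {Eg} => [|[|]].
  exists (pdiv h); rewrite pdiv_prime // (dvdn_odd (pdiv_dvd h)) //.
  by rewrite Eg dvdn_mull ?pdiv_dvd.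
have [i Eh] : exists i, h = 2 * i by exists h./2; rewrite mul2n even_halfK.
by exists 2; rewrite Eg Eh; split=> //=; rewrite ?mulnA dvdn_mulr.
Qed.

Lemma expn_mulS m d k : exists x, (m * d + 1) ^ k = m * x + 1.
Proof.
elim: k => [|k [x IH]]; first by exists 0; rewrite muln0.
by exists (m * d * x + d + x); rewrite expnS IH; lia.
Qed.

(** D = K + P^2 with K = 1 mod 4p and p dividing P. For odd p, an even P gives D = 1 mod 4p, and an
    odd P gives D = 2 mod 4 and D = 1 mod p. For p = 2, 4 divides P, so D = 1 mod 8. *)
Lemma Dval_split (b s k p : nat) : prime p -> p %| b -> p %| s ->
  odd p || (p == 2) && (4 %| gcdn b s) ->
  (exists d, Dval b s k = 4 * p * d + 1) \/
  [/\ odd p, (exists d, Dval b s k = p * d + 1) & (exists d, Dval b s k = 4 * d + 2)].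
Proof.
move=> p_prime /dvdnP[b' Eb] /dvdnP[s' Es] Hp.
have [x Ex] : exists x, (4 * b * s + 1) ^ k = 4 * p * x + 1.
  have -> : 4 * b * s + 1 = 4 * p * (b' * s) + 1 by rewrite Eb; lia.
  exact: expn_mulS.
rewrite /Dval Ex; set P := b * _ + s.
have [P' EP] : exists P', P = p * P'.
  by exists (b' * (4 * p * x + 1) + s'); rewrite /P {1}Eb Es; lia.
have EP4 : (4 %| gcdn b s) -> exists i, P = 4 * i.
  rewrite dvdn_gcd => /andP[/dvdnP[b4 Eb4] /dvdnP[s4 Es4]].
  by exists (b4 * (4 * p * x + 1) + s4); rewrite /P {1}Eb4 Es4; lia.
clearbody P; case/orP: Hp => [p_odd|/andP[/eqP p2]].
  have [P_odd|P_even] := boolP (odd P); [right|left].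
    split=> //; first by exists (4 * x + P' * P); rewrite -mulnn {1}EP; lia.
    have EP2 : P = 2 * P./2 + 1 by rewrite -{1}(odd_double_half P) P_odd mul2n addnC.
    by move: P./2 EP2 => h ->; exists (p * x + h ^ 2 + h); lia.
  have P'_even : ~~ odd P' by move: P_even; rewrite EP oddM p_odd.
  have := even_halfK P'_even; rewrite -mul2n; move: P'./2 => h Eh.
  by exists (x + p * h ^ 2); rewrite EP -Eh; lia.
move=> /EP4[i ->]; left; exists (x + 2 * i ^ 2); rewrite p2; lia.
Qed.

Theorem proposition1p3 (b s k : nat) (hb : 0 < b) (hs : 0 < s) (hk : 0 < k)
    (hD : squarefree (Dval b s k)) (hgcd : 2 < gcdn b s) :
  1 < class_number (Dval b s k).
Proof.
have D_gt1 : 1 < Dval b s k.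
  by rewrite /Dval -addn1 leq_add ?expn_gt0 ?addn1 //= addn_gt0 hs orbT.
have [p [p_prime p_dvd p_split]] := exists_split_prime hgcd.
have /andP[pb ps] : (p %| b) && (p %| s) by rewrite -dvdn_gcd.
have D_split := Dval_split k p_prime pb ps p_split.
apply: (class_number_gt1 D_gt1 hD (prime_above_ideal D_gt1 hD p_prime D_split)) => g Ig.
apply: (prime_above_not_principal D_gt1 hD p_prime D_split) => // x y.
exact: no_norm_4p.
Qed.
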